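(* Let $c>1$, $\theta\in(0,\pi/2)$ and let $a,b\in\mathbb{R}$ be constants. Let $M$ be a Riemannian surface with coordinates $(x,y)$ and metric $e^{f(x,y)}(dx^2+dy^2)$, and let $E_c$ be the ellipsoid with metric $$(c^2\sin^2R+\cos^2R)\,dR^2+\sin^2R\,dS^2 .$$ Then the map $u=(R,S):M\to E_c$ given by $$R(x,y)=\arccos\left(\cos\theta\,\sin\left(\frac{ay-bx}{\sqrt{c^2-1}}\right)\right),$$ $$S(x,y)=ax+by+\arctan\left(\sin\theta\,\tan\left(\frac{ay-bx}{\sqrt{c^2-1}}\right)\right)$$ is a harmonic map on the open set where the map is well defined and its Jacobian is nonvanishing.
   Context: $E_c$ denotes the ellipsoid $\frac{x^2}{c^2}+y^2+z^2=1$ in $\mathbb{R}^3$ with the induced metric, which in the coordinates $(R,S)$ has the displayed form. Here $f$ is a smooth real function, and the Jacobian of $u$ is the determinant $R_xS_y-R_yS_x$. A smooth map $u=(R,S)$ into a surface with metric $A(R)dR^2+B(R)dS^2$ from a surface with metric $e^{f}(dx^2+dy^2)$ is called harmonic if it is a critical point (with respect to smooth compactly supported variations of $(R,S)$) of the energy, which up to a positive constant factor is $$E(u)=\int\Bigl(A(R)(R_x^2+R_y^2)+B(R)(S_x^2+S_y^2)\Bigr)dx\,dy;$$ here $A(R)=c^2\sin^2R+\cos^2R$ and $B(R)=\sin^2R$. *)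

(* Defs.v *)
From HB Require Import structures.
From mathcomp Require Import all_boot all_order all_algebra.
From mathcomp Require Import all_classical all_reals all_analysis.

Set Implicit Arguments.
Unset Strict Implicit.
Unset Printing Implicit Defensive.

Import Order.TTheory GRing.Theory Num.Theory.
Import numFieldNormedType.Exports.
Local Open Scope classical_set_scope.
Local Open Scope ring_scope.

(** For open [D], [f] is of class C^n on [D]: all iterated directional
    derivatives of order at most [n] exist and are continuous on [D]. *)
Fixpoint Ck (R : realType) (V : normedModType R) (n : nat) (D : set V)
    (f : V -> R) : Prop :=
  (forall x, D x -> {for x, continuous f}) /\
  match n with
  | 0%N => True
  | m.+1 => forall v : V,
      (forall x, D x -> derivable f x v) /\ Ck m D (fun x => 'D_v f x)
  end.

Definition smooth_on (R : realType) (V : normedModType R) (D : set V)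
    (f : V -> R) : Prop :=
  forall n, Ck n D f.

Section HarmonicMaps.
Context {R : realType}.

Definition pdx (g : R * R -> R) (p : R * R) : R := 'D_((1, 0) : R * R) g p.
Definition pdy (g : R * R -> R) (p : R * R) : R := 'D_((0, 1) : R * R) g p.

Definition cR (u : R * R -> R * R) (p : R * R) : R := (u p).1.
Definition cS (u : R * R -> R * R) (p : R * R) : R := (u p).2.

Definition jac (u : R * R -> R * R) (p : R * R) : R :=
  pdx (cR u) p * pdy (cS u) p - pdy (cR u) p * pdx (cS u) p.

(** The squared norm of [du] for the source metric [e^f (dx^2 + dy^2)] and the
    target metric [A(R) dR^2 + B(R) dS^2]. *)
Definition sqnorm_du (f : R * R -> R) (A B : R -> R) (u : R * R -> R * R)
    (p : R * R) : R :=
  expR (- f p) *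
  (A (cR u p) * (pdx (cR u) p ^+ 2 + pdy (cR u) p ^+ 2) +
   B (cR u p) * (pdx (cS u) p ^+ 2 + pdy (cS u) p ^+ 2)).

(** The area element of the source metric is [e^f dx dy]. *)
Definition energy (f : R * R -> R) (A B : R -> R) (K : set (R * R))
    (u : R * R -> R * R) : R :=
  (\int[(lebesgue_measure \x lebesgue_measure)%E]_(p in K)
     (sqnorm_du f A B u p * expR (f p)))%R.

Lemma energyE f A B K u : energy f A B K u =
  (\int[(lebesgue_measure \x lebesgue_measure)%E]_(p in K)
     (A (cR u p) * (pdx (cR u) p ^+ 2 + pdy (cR u) p ^+ 2) +
      B (cR u p) * (pdx (cS u) p ^+ 2 + pdy (cS u) p ^+ 2)))%R.
Proof.
rewrite /energy; congr Rintegral; apply/funext => p.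
by rewrite /sqnorm_du mulrAC -expRD addNr expR0 mul1r.
Qed.

(** [h s], for [`|s| < e], is a smooth variation of [u : W -> J x R] through
    maps [W -> J x R], constant in [s] outside [K]. *)
Definition compact_variation (J : set R) (W K : set (R * R)) (u : R * R -> R * R)
    (e : R) (h : R -> R * R -> R * R) : Prop :=
  let D := [set q : R * (R * R) | `|q.1| < e /\ W q.2] in
  [/\ smooth_on D (fun q => cR (h q.1) q.2),
      smooth_on D (fun q => cS (h q.1) q.2),
      forall q, D q -> J (cR (h q.1) q.2),
      forall p, W p -> h 0 p = u p &
      forall q, D q -> ~ K q.2 -> h q.1 q.2 = u q.2].

(** Harmonicity on [W], with metric [e^f (dx^2 + dy^2)], of a map into the
    surface with coordinates [(R, S)] in [J x R] and metric
    [A(R) dR^2 + B(R) dS^2].  The energy over [W] may be infinite; as usual the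
    first variation is computed on a compact set outside which nothing moves. *)
Definition harmonic_on (f : R * R -> R) (A B : R -> R) (J : set R)
    (W : set (R * R)) (u : R * R -> R * R) : Prop :=
  [/\ open W,
      smooth_on W (cR u),
      smooth_on W (cS u),
      forall p, W p -> J (cR u p) &
      forall (K : set (R * R)) (e : R) (h : R -> R * R -> R * R),
        compact K -> K `<=` W -> 0 < e -> compact_variation J W K u e h ->
        is_derive (0 : R) 1 (fun s : R => energy f A B K (h s)) 0].

Definition ellA (c t : R) : R := c ^+ 2 * sin t ^+ 2 + cos t ^+ 2.
Definition ellB (t : R) : R := sin t ^+ 2.

(** The values of the coordinate [R] away from the two poles of the ellipsoid,
    where [(R, S)] are local coordinates. *)
Definition ell_chart : set R := [set t | 0 < t < pi].

Definition phase (a b c : R) (p : R * R) : R :=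
  (a * p.2 - b * p.1) / Num.sqrt (c ^+ 2 - 1).

Definition umap (a b c theta : R) (p : R * R) : R * R :=
  (acos (cos theta * sin (phase a b c p)),
   a * p.1 + b * p.2 + atan (sin theta * tan (phase a b c p))).

(** [tan] is total in the library, with the value [0] where [cos] vanishes, so
    the domain of the formula for [S] has to be specified. *)
Definition umap_dom (a b c : R) : set (R * R) :=
  [set p | cos (phase a b c p) != 0].

End HarmonicMaps.

(* Main.v *)
Require Import Defs.
From mathcomp Require Import all_boot all_order all_algebra.
From mathcomp Require Import all_classical all_reals all_analysis.
From mathcomp Require Import ring lra.

Set Implicit Arguments.
Unset Strict Implicit.
Unset Printing Implicit Defensive.

Import Order.TTheory GRing.Theory Num.Theory.
Import numFieldNormedType.Exports.
Local Open Scope classical_set_scope.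
Local Open Scope ring_scope.

(** Harmonicity says that the energy over a compact set [K] is stationary under
    variations that move nothing outside [K]; the factor [e^f] cancels out of the
    energy, so the source metric may be taken flat.  Stationarity follows from
    the Euler-Lagrange equations
      [2 div (A grad R) = A' |grad R|^2 + B' |grad S|^2]  and
      [div (B grad S) = 0],
    and these are checked by hand for the map at issue.

    From the equations to stationarity ([energy_stationary]).  Let [u = (R, S)]
    solve the equations, let [w] be a member of the variation, and put
    [r = R_w - R], [s = S_w - S] and [V = r A grad R + s B grad S].  By the
    equations, [2 div V] is exactly the part of the difference of the two energy
    densities that is linear in [r], [s] and their gradients.  The field [V]
    vanishes outside [K], so that [div V] has integral zero
    ([integral_div_eq0]), and the difference of the two energies is the integral
    of a quadratic remainder.  Since [r], [s] and their gradients are [O(t)]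
    uniformly on [K], where [t] is the parameter of the variation
    ([variation_bound]), the energy differs from its value at [0] by [O(t^2)],
    and its derivative there is zero.  Proceeding by finite differences, rather
    than differentiating under the integral sign, requires no exchange of the
    derivatives in [t] and in [x], [y].

    Nothing is known about the boundary of [K].  The divergence theorem holds all
    the same because [V], extended by zero, is of class C^1 on the whole plane:
    the open sets [W] and the complement of [K] cover the plane, and the
    extension is C^1 on each of them.

    The equations for the map ([euler_lagrange_umap]).  With
    [phi = (a y - b x) / k] and [k^2 = c^2 - 1], the pair
    [arccos (cos theta sin phi)], [arctan (sin theta tan phi)] runs along a great
    circle of the unit sphere, whose angular momentum is [sin theta].  In terms of
    [psi = dR/dphi] this gives the first integral
    [psi^2 + sin^2 theta / sin^2 R = 1] ([sqr_psi]), from which [d psi/d phi]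
    is obtained ([is_derive_psi]).  The linear function [a x + b y] that is added
    to [S] has a gradient orthogonal to that of [phi], of squared norm
    [k^2 |grad phi|^2].  Orthogonality gives [div (B grad S) = 0], as
    [B grad S = sin^2 R (a, b) + sin theta grad phi] and [R] depends on [phi]
    only; the norm, with [A = 1 + k^2 sin^2 R], makes the contribution of the
    linear function to the first equation cancel that of the metric of the
    ellipsoid. *)

(** * Functions of class C^n *)

Section CkCalculus.
Context {R : realType} {V : normedModType R}.
Implicit Types (D : set V) (f g : V -> R) (n : nat).

Lemma Ck_continuous n D f x : Ck n D f -> D x -> {for x, continuous f}.
Proof. by case: n => [|n] [cf _]; exact: cf. Qed.

Lemma CkS_derivable n D f v x : Ck n.+1 D f -> D x -> derivable f x v.
Proof. by move=> [_ /(_ v)[df _]]; exact: df. Qed.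

Lemma CkS_is_derive n D f v x :
  Ck n.+1 D f -> D x -> is_derive x v f ('D_v f x).
Proof. by move=> Cf Dx; apply/derivableP; exact: CkS_derivable Cf Dx. Qed.

Lemma CkS_derive n D f v : Ck n.+1 D f -> Ck n D (fun x => 'D_v f x).
Proof. by move=> [_ /(_ v)[]]. Qed.

Lemma Ck_pred n D f : Ck n.+1 D f -> Ck n D f.
Proof.
elim: n f => [|n IHn] f; first by move=> [cf _]; split.
move=> Cf; split; first by move=> x; exact: Ck_continuous Cf.
move=> v; split; first by move=> x; exact: CkS_derivable Cf.
exact/IHn/CkS_derive.
Qed.

Lemma Ck_le m n D f : (m <= n)%N -> Ck n D f -> Ck m D f.
Proof.
move=> /subnKC <-; elim: (n - m)%N => [|k IHk]; first by rewrite addn0.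
by rewrite addnS => /Ck_pred.
Qed.

Lemma near_eq_continuous D f g x : open D -> {in D, f =1 g} -> D x ->
  {for x, continuous f} -> {for x, continuous g}.
Proof.
move=> oD fg Dx cf; rewrite /prop_for /continuous_at -(fg _ (mem_set Dx)).
apply: cvg_trans cf; apply: near_eq_cvg; near=> y.
by apply: fg; apply: mem_set; near: y; exact: open_nbhs_nbhs.
Unshelve. all: by end_near. Qed.

Lemma Ck_eq n D f g : open D -> {in D, f =1 g} -> Ck n D f -> Ck n D g.
Proof.
move=> oD; elim: n f g => [|n IHn] f g fg Cf.
  by split=> // x Dx; exact: near_eq_continuous oD fg Dx (Ck_continuous Cf Dx).
have nfg x : D x -> {near x, f =1 g}.
  move=> Dx; near=> y; apply: fg; apply: mem_set; near: y.
  exact: open_nbhs_nbhs.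
split=> [x Dx|v]; first exact: near_eq_continuous oD fg Dx (Ck_continuous Cf Dx).
split=> [x Dx|].
  by apply: near_eq_derivable (nfg x Dx) _; exact: CkS_derivable Cf Dx.
apply: IHn (CkS_derive v Cf) => x /set_mem Dx.
exact: near_eq_derive (nfg x Dx).
Unshelve. all: by end_near. Qed.

(** The way in from derivatives given by formulas, which may hold on [D] only. *)
Lemma CkS_intro n D f (df : V -> V -> R) : open D ->
  (forall x, D x -> {for x, continuous f}) ->
  (forall v x, D x -> is_derive x v f (df v x)) ->
  (forall v, Ck n D (df v)) -> Ck n.+1 D f.
Proof.
move=> oD cf dfE Cdf; split=> // v; split=> [x /(dfE v)[]//|].
by apply: Ck_eq (Cdf v) => // x /set_mem /(dfE v)[].
Qed.

Lemma Ck_cst n D (k : R) : Ck n D (cst k).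
Proof.
elim: n k => [|n IHn] k; split; try by move=> x _; exact: cvg_cst.
  by [].
move=> v; split=> [x Dx|]; first exact: derivable_cst.
rewrite (_ : (fun x => _) = cst 0) //.
by apply/funext => x; rewrite derive_cst.
Qed.

Lemma Ck_add n D f g : open D -> Ck n D f -> Ck n D g ->
  Ck n D (fun x => f x + g x).
Proof.
move=> oD; elim: n f g => [|n IHn] f g Cf Cg.
  split=> // x Dx; exact: cvgD (Ck_continuous Cf Dx) (Ck_continuous Cg Dx).
apply: (@CkS_intro _ _ _ (fun v x => 'D_v f x + 'D_v g x)) => //.
- move=> x Dx; exact: cvgD (Ck_continuous Cf Dx) (Ck_continuous Cg Dx).
- move=> v x Dx.
  exact: is_deriveD (CkS_is_derive v Cf Dx) (CkS_is_derive v Cg Dx).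
- by move=> v; apply: IHn; exact: CkS_derive.
Qed.

Lemma Ck_mul n D f g : open D -> Ck n D f -> Ck n D g ->
  Ck n D (fun x => f x * g x).
Proof.
move=> oD; elim: n f g => [|n IHn] f g Cf Cg.
  split=> // x Dx; exact: cvgM (Ck_continuous Cf Dx) (Ck_continuous Cg Dx).
apply: (@CkS_intro _ _ _ (fun v x => f x * 'D_v g x + g x * 'D_v f x)) => //.
- move=> x Dx; exact: cvgM (Ck_continuous Cf Dx) (Ck_continuous Cg Dx).
- move=> v x Dx.
  exact: is_deriveM (CkS_is_derive v Cf Dx) (CkS_is_derive v Cg Dx).
- move=> v; apply: Ck_add => //.
    by apply: IHn; [exact: Ck_pred|exact: CkS_derive].
  by apply: IHn; [exact: Ck_pred|exact: CkS_derive].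
Qed.

Lemma Ck_opp n D f : open D -> Ck n D f -> Ck n D (fun x => - f x).
Proof.
move=> oD Cf; apply: Ck_eq (Ck_mul oD (Ck_cst n D (- 1)) Cf) => //.
by move=> x _; rewrite mulN1r.
Qed.

Lemma Ck_sub n D f g : open D -> Ck n D f -> Ck n D g ->
  Ck n D (fun x => f x - g x).
Proof. by move=> oD Cf Cg; apply: Ck_add => //; exact: Ck_opp. Qed.

(** The derivative of [1/f] is expressed by [1/f] itself, so that the induction
    needs no formula for higher derivatives. *)
Lemma Ck_inv n D f : open D -> (forall x, D x -> f x != 0) ->
  Ck n D f -> Ck n D (fun x => (f x)^-1).
Proof.
move=> oD f0; have cV m : Ck m D f ->
    forall x, D x -> {for x, continuous (fun x => (f x)^-1)}.
  by move=> Cf x Dx; exact: cvgV (f0 _ Dx) (Ck_continuous Cf Dx).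
elim: n => [|n IHn] Cf; first by split=> //; exact: cV Cf.
apply: (@CkS_intro _ _ _ (fun v x => - (f x)^-1 * (f x)^-1 * 'D_v f x)) => //.
- exact: cV Cf.
- move=> v x Dx; have Dfx : derivable f x v := CkS_derivable Cf Dx.
  apply: DeriveDef.
    exact: derivableV (f0 _ Dx) Dfx.
  by rewrite deriveV ?f0// mulNr -invfM -expr2.
- move=> v; have CV := IHn (Ck_pred Cf).
  apply: Ck_mul (CkS_derive v Cf) => //; apply: Ck_mul => //.
  exact: Ck_opp.
Qed.

Lemma is_deriveD_fun f g x v df dg :
  is_derive x v f df -> is_derive x v g dg ->
  is_derive x v (fun y => f y + g y) (df + dg).
Proof. by move=> hf hg; exact: is_deriveD. Qed.

Lemma is_deriveM_fun f g x v df dg :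
  is_derive x v f df -> is_derive x v g dg ->
  is_derive x v (fun y => f y * g y) (f x * dg + g x * df).
Proof. by move=> hf hg; exact: is_deriveM. Qed.

Lemma is_deriveV_fun f x v df : f x != 0 ->
  is_derive x v f df -> is_derive x v (fun y => (f y)^-1) (- (f x) ^- 2 * df).
Proof.
move=> f0 [fv <-]; apply: DeriveDef; first exact: derivableV.
exact: deriveV.
Qed.

(** The directional derivative of [f] at [x] is that of the curve
    [t |-> f (x + t v)], which reduces the statement to one variable. *)
Lemma is_derive_comp1 f (g : R -> R) x v df dg : is_derive x v f df ->
  is_derive (f x) 1 g dg -> is_derive x v (fun y => g (f y)) (dg * df).
Proof.
move=> [fv fE] [gv gE]; pose c (t : R) := f (t *: v + x).
have c0 : c 0 = f x by rewrite /c scale0r add0r.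
have dcv : derivable c 0 1 := (derivable1P f x v).1 fv.
have curve (h : V -> R) : 'D_v h x = 'D_1 (fun t : R => h (t *: v + x)) 0.
  rewrite /derive; congr (lim _).
  set g1 := fun t => t^-1 *: _; set g2 := fun t => t^-1 *: _.
  suff -> : g1 = g2 by [].
  by apply/funext => t; rewrite /g1 /g2 /= addr0 scale0r add0r [_%:A]mulr1.
have dcE : 'D_1 c 0 = df by rewrite -fE curve.
have [gcv gcE] : derivable (g \o c) 0 1 /\ 'D_1 (g \o c) 0 = dg * df.
  move: c0 dcv dcE; move: (c) => {}c c0 dcv dcE.
  have gc : derivable g (c 0) 1 by rewrite c0; exact: gv.
  split; last first.
    by rewrite -derive1E (derive1_comp dcv gc) !derive1E dcE c0 gE.
  apply/derivable1_diffP/differentiable_comp; exact/derivable1_diffP.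
apply: DeriveDef; first exact: (derivable1P (g \o f) x v).2 gcv.
by rewrite curve; exact: gcE.
Qed.

Lemma Ck_sqr n D f : open D -> Ck n D f -> Ck n D (fun x => f x ^+ 2).
Proof. by move=> oD Cf; exact: Ck_mul. Qed.

(** [Ck] constrains [f] at each point separately.  This is how the extension by
    zero of a compactly supported field is seen to be regular. *)
Lemma Ck_setU n (D E : set V) f : Ck n D f -> Ck n E f -> Ck n (D `|` E) f.
Proof.
elim: n f => [|n IHn] f Cf Cg.
  by split=> // x [] Dx; [exact: Ck_continuous Cf Dx|exact: Ck_continuous Cg Dx].
split=> [x [] Dx|v]; [exact: Ck_continuous Cf Dx|exact: Ck_continuous Cg Dx|].
split=> [x [] Dx|]; [exact: CkS_derivable Cf Dx|exact: CkS_derivable Cg Dx|].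
by apply: IHn; exact: CkS_derive.
Qed.

End CkCalculus.

Section CkComposition.
Context {R : realType} {V : normedModType R}.

Lemma Ck_comp n (D : set V) (g : R -> R) (f : V -> R) : open D ->
  Ck n setT g -> Ck n D f -> Ck n D (fun x => g (f x)).
Proof.
have cg m m' (k : R -> R) : Ck m setT k -> Ck m' D f ->
    forall x, D x -> {for x, continuous (fun x => k (f x))}.
  move=> Cgk Cf x Dx.
  have ck : {for f x, continuous k}.
    exact: Ck_continuous Cgk (I : [set: R] (f x)).
  exact: (@continuous_comp _ _ _ f k x (Ck_continuous Cf Dx) ck).
move=> oD; elim: n g => [|n IHn] g Cg Cf; first by split=> //; exact: cg Cg Cf.
apply: (@CkS_intro _ _ _ _ _ (fun v x => 'D_1 g (f x) * 'D_v f x)) => //.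
- exact: cg Cg Cf.
- move=> v x Dx; apply: is_derive_comp1 (CkS_is_derive v Cf Dx) _.
  exact: CkS_is_derive Cg (I : [set: R] (f x)).
- move=> v; apply: Ck_mul (CkS_derive v Cf) => //.
  exact: IHn (CkS_derive (1 : R) Cg) (Ck_pred Cf).
Qed.

End CkComposition.

Section Trigonometric.
Context {R : realType}.

(** Each of the two is the derivative of the other, up to sign, so that neither
    induction goes through alone. *)
Lemma Ck_sin_cos n : Ck n setT (@sin R) /\ Ck n setT (@cos R).
Proof.
have idD (v x : R) : is_derive x v id v by exact: is_derive_id.
elim: n => [|n [Cs Cc]].
  by split; split=> // x _; [exact: continuous_sin|exact: continuous_cos].
have oT := @openT R.
split.
  apply: (@CkS_intro _ _ _ _ _ (fun v x => cos x * v)) => //.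
  - by move=> x _; exact: continuous_sin.
  - by move=> v x _; exact: is_derive_comp1 (idD v x) (is_derive_sin x).
  - by move=> v; exact: Ck_mul oT Cc (Ck_cst _ _ _).
apply: (@CkS_intro _ _ _ _ _ (fun v x => - sin x * v)) => //.
- by move=> x _; exact: continuous_cos.
- by move=> v x _; exact: is_derive_comp1 (idD v x) (is_derive_cos x).
- by move=> v; exact: Ck_mul oT (Ck_opp oT Cs) (Ck_cst _ _ _).
Qed.

End Trigonometric.

Section AffinePullback.
Context {R : realType} {U V : normedModType R}.

(** Restricting to a line in the plane, to the slice of a variation at a fixed
    parameter or to the path of a fixed point are all pullbacks along affine maps;
    the hypothesis says that [w] is the image of [v] under the linear part. *)
Lemma is_derive_affine (i : U -> V) (f : V -> R) x v w df :
  (forall t : R, i (t *: v + x) = t *: w + i x) ->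
  is_derive (i x) w f df -> is_derive x v (fun y => f (i y)) df.
Proof.
move=> iE [fw <-].
have E : (fun h : R => h^-1 *: (((fun y => f (i y)) \o shift x) (h *: v) -
    f (i x))) = (fun h : R => h^-1 *: ((f \o shift (i x)) (h *: w) - f (i x))).
  by apply/funext => h /=; rewrite iE.
by apply: DeriveDef; rewrite /derivable /derive E.
Qed.

Lemma derive_affine (i : U -> V) (f : V -> R) x v w :
  (forall t : R, i (t *: v + x) = t *: w + i x) ->
  'D_v (fun y => f (i y)) x = 'D_w f (i x).
Proof.
move=> iE; rewrite /derive.
have -> // : (fun h : R => h^-1 *: (((fun y => f (i y)) \o shift x) (h *: v) -
    f (i x))) = (fun h : R => h^-1 *: ((f \o shift (i x)) (h *: w) - f (i x))).
by apply/funext => h /=; rewrite iE.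
Qed.

Lemma Ck_affine n (D : set U) (E : set V) (i : U -> V) (f : V -> R)
    (di : U -> V) : open D -> continuous i -> (forall x, D x -> E (i x)) ->
  (forall x v (t : R), i (t *: v + x) = t *: di v + i x) ->
  Ck n E f -> Ck n D (fun x => f (i x)).
Proof.
move=> oD ci DE iE.
have cfi m (g : V -> R) : Ck m E g ->
    forall x, D x -> {for x, continuous (fun x => g (i x))}.
  move=> Cg x Dx.
  exact: (@continuous_comp _ _ _ i g x (ci x) (Ck_continuous Cg (DE _ Dx))).
elim: n f => [|n IHn] f Cf; first by split=> //; exact: cfi Cf.
apply: (@CkS_intro _ _ _ _ _ (fun v x => 'D_(di v) f (i x))) => //.
- exact: cfi Cf.
- move=> v x Dx.
  exact: is_derive_affine (iE x v) (CkS_is_derive _ Cf (DE _ Dx)).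
- by move=> v; exact: (IHn (fun y => 'D_(di v) f y) (CkS_derive (di v) Cf)).
Qed.

End AffinePullback.

Section LinearForms.
Context {R : realType}.

Lemma continuous_coord (p : R * R) : {for p, continuous (@fst R R)} /\
  {for p, continuous (@snd R R)}.
Proof. by split; [exact: cvg_fst|exact: cvg_snd]. Qed.

Lemma is_derive_linear (l m : R) (p v : R * R) :
  is_derive p v (fun q : R * R => l * q.1 + m * q.2) (l * v.1 + m * v.2).
Proof.
apply: (is_derive_affine (i := fun q : R * R => l * q.1 + m * q.2)
  (f := id) _ (is_derive_id _ _)) => t /=.
rewrite -[t *: (_ + _)]/(t * (_ + _)).
by rewrite -[t *: v.1]/(t * v.1) -[t *: v.2]/(t * v.2); ring.
Qed.

Lemma Ck_linear n (D : set (R * R)) (l m : R) : open D ->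
  Ck n D (fun p : R * R => l * p.1 + m * p.2).
Proof.
move=> oD; have cl (p : R * R) : D p ->
    {for p, continuous (fun p : R * R => l * p.1 + m * p.2)}.
  move=> _; have [c1p c2p] := continuous_coord p.
  apply: cvgD; apply: cvgM; first exact: cvg_cst.
  - exact: c1p.
  - exact: cvg_cst.
  - exact: c2p.
case: n => [|n]; first by split.
apply: (@CkS_intro _ _ _ _ _ (fun v _ => l * v.1 + m * v.2)) => //.
- by move=> v p _; exact: is_derive_linear.
- by move=> v; exact: Ck_cst.
Qed.

Lemma open_neq0 (W : set (R * R)) (g : R * R -> R) : open W -> Ck 0 W g ->
  open [set p | W p /\ g p != 0].
Proof.
move=> oW Cg; rewrite openE => p [Wp gp].
apply: filterI; first exact: open_nbhs_nbhs.
have cg := Ck_continuous Cg Wp; apply: (cg [set x : R | x != 0]).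
by apply: open_nbhs_nbhs; split=> //; exact: open_neq.
Qed.

End LinearForms.

(** * Continuous functions on compact sets of the plane *)

Section PlaneMeasure.
Context {R : realType}.
Local Notation mu := (@lebesgue_measure R).
Local Notation mu2 := (@product_measure1 _ _ _ _ R mu mu).

(** An open set of the plane is the union of the rational rectangles that it
    contains, and these are countably many.  This makes functions
    that are continuous for the product topology measurable for the product
    sigma-algebra, on which the energy is an integral. *)
Lemma open_measurable2 (A : set (R * R)) : open A ->
  measurable (A : set (measurableTypeR R * measurableTypeR R)).
Proof.
move=> oA.
pose box (q : (rat * rat) * (rat * rat)) : set (R * R) :=
  `]ratr q.1.1, ratr q.1.2[%classic `*` `]ratr q.2.1, ratr q.2.2[%classic.
pose F q : set (R * R) := if `[< box q `<=` A >] then box q else set0.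
have -> : A = \bigcup_q F q.
  apply/seteqP; split=> [[x y] Axy|p [q _]]; last first.
    by rewrite /F; case: asboolP => // + bp; exact.
  have [e /= e0 eA] : exists2 e : R, 0 < e & ball (x, y) e `<=` A.
    by apply/nbhs_ballP; exact: open_nbhs_nbhs.
  have lt1 (z : R) : z - e < z by rewrite ltrBlDr ltrDl.
  have lt2 (z : R) : z < z + e by rewrite ltrDl.
  have [q1 q1P] := rat_in_itvoo (lt1 x); have [q2 q2P] := rat_in_itvoo (lt2 x).
  have [q3 q3P] := rat_in_itvoo (lt1 y); have [q4 q4P] := rat_in_itvoo (lt2 y).
  exists ((q1, q2), (q3, q4)) => //.
  move: q1P q2P q3P q4P; rewrite !in_itv/= => /andP[a1 a2] /andP[b1 b2].
  move=> /andP[c1 c2] /andP[d1 d2].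
  rewrite /F asboolT; last first.
    move=> [u v]; rewrite /box /= !in_itv /= => -[/andP[u1 u2] /andP[v1 v2]].
    by apply: eA; split; rewrite /ball /= ltr_distlC; apply/andP; split; lra.
  by rewrite /box /= !in_itv /= a2 b1 c2 d1.
apply: countable_bigcupT_measurable => [|q]; first exact: countableP.
rewrite /F; case: ifP => _; last exact: measurable0.
by apply: measurableX; exact: measurable_itv.
Qed.

Lemma compact_measurable2 (K : set (R * R)) : compact K ->
  measurable (K : set (measurableTypeR R * measurableTypeR R)).
Proof.
move=> /(compact_closed (@norm_hausdorff _ _)) /closed_openC.
by move=> /open_measurable2 /measurableC; rewrite setCK.
Qed.

Lemma continuous_measurable2 (K W : set (R * R)) (f : R * R -> R) :
  compact K -> open W -> K `<=` W ->
  (forall p, W p -> {for p, continuous f}) ->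
  measurable_fun (K : set (measurableTypeR R * measurableTypeR R)) f.
Proof.
move=> cK oW KW cf.
apply: (measurability _ (measurable_realfun.RGenOpens.measurableE R)).
move=> _ [_ [a [b ->] <-]].
rewrite (_ : _ `&` _ = K `&` (W `&` f @^-1` `]a, b[%classic)); last first.
  by rewrite setIA (setIidl KW).
apply: measurableI; first exact: compact_measurable2.
apply: open_measurable2; rewrite openE => p [Wp fp].
apply: filterI; first exact: open_nbhs_nbhs.
by apply: (cf p Wp); apply: open_nbhs_nbhs; split=> //; exact: interval_open.
Qed.

Lemma compact_bound (T : topologicalType) (K W : set T) (f : T -> R) :
  compact K -> K `<=` W -> (forall p, W p -> {for p, continuous f}) ->
  exists2 C : R, 0 < C & forall p, K p -> `|f p| <= C.
Proof.
move=> cK KW cf.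
have : compact (f @` K).
  apply: continuous_compact => //; apply: continuous_in_subspaceT => p /set_mem.
  by move=> /KW /cf.
move=> /compact_bounded /ex_strict_bound_gt0[C C0 CP].
by exists C => // p Kp; exact/ltW/CP/imageP.
Qed.

Lemma compact_box (K : set (R * R)) : compact K ->
  exists2 N : R, 0 < N & K `<=` `[-N, N]%classic `*` `[-N, N]%classic.
Proof.
move=> cK.
have [N N0 NP] := @compact_bound _ K setT (fun p => `|p|) cK (@subsetT _ _)
  (fun p _ => @norm_continuous _ _ p).
exists N => // -[x y] /NP; rewrite normr_id prod_normE/= ge_max !ler_norml.
move=> /andP[].
by rewrite /= !in_itv.
Qed.

Lemma compact_measure2_fin (K : set (R * R)) : compact K -> (mu2 K < +oo)%E.
Proof.
move=> cK; have [N N0 KN] := compact_box cK.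
apply: (@le_lt_trans _ _ (mu2 (`[-N, N]%classic `*` `[-N, N]%classic))).
  apply: le_measure => //; rewrite inE; first exact: compact_measurable2.
  by apply: measurableX; exact: measurable_itv.
rewrite product_measure1E//= lebesgue_measure_itv /=.
by case: ifP => _; rewrite -?EFinB -?EFinM ?ltry ?mul0e.
Qed.

Lemma compact_integrable2 (K W : set (R * R)) (f : R * R -> R) :
  compact K -> open W -> K `<=` W ->
  (forall p, W p -> {for p, continuous f}) -> mu2.-integrable K (EFin \o f).
Proof.
move=> cK oW KW cf; apply: measurable_bounded_integrable.
- exact: compact_measurable2.
- exact: compact_measure2_fin.
- exact: continuous_measurable2 oW KW cf.
- have [C C0 CP] := compact_bound cK KW cf.
  exists C; split; first exact: num_real.
  by move=> x Cx p Kp; exact: le_trans (CP p Kp) (ltW Cx).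
Qed.

End PlaneMeasure.

(** * The divergence theorem without boundary *)

Section Divergence.
Context {R : realType}.
Local Notation mu := (@lebesgue_measure R).
Local Notation mu2 := (@product_measure1 _ _ _ _ R mu mu).
Implicit Types (g : R * R -> R) (K W : set (R * R)).

Lemma integral_derive_eq0 (g : R -> R) (N : R) :
  (forall x, derivable g x 1) -> continuous (derive1 g) ->
  (forall x, N < `|x| -> g x = 0) -> (\int[mu]_x (derive1 g x)%:E = 0)%E.
Proof.
move=> dg cg g0.
have cg0 x : {for x, continuous g}.
  exact/differentiable_continuous/derivable1_diffP.
pose M : R := `|N| + 1.
have NM : N < M by rewrite (le_lt_trans (ler_norm _))// /M ltrDl.
have M0 : 0 < M by rewrite /M ltr_pwDr.
have dg0 x : M < `|x| -> derive1 g x = 0.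
  move=> Mx; rewrite derive1E -(derive_cst (0 : R) x (1 : R)).
  apply: near_eq_derive; near=> z; apply: g0.
  apply: (lt_trans NM); near: z.
  apply: (@norm_continuous _ _ x (fun z => M < z)).
  by apply: open_nbhs_nbhs; split=> //; exact: open_gt.
have gM : g M = 0 by apply: g0; rewrite gtr0_norm.
have gNM : g (- M) = 0 by apply: g0; rewrite normrN gtr0_norm.
transitivity (\int[mu]_(x in `[(- M)%R, M]) (derive1 g x)%:E)%E.
  rewrite [RHS]integral_mkcond; apply: eq_integral => x _.
  rewrite patchE; case: ifPn => // /negP xM; rewrite dg0//.
  rewrite ltNge; apply/negP => xM'; apply: xM; rewrite inE/= in_itv/=.
  by rewrite -ler_norml.
transitivity ((g M)%:E - (g (- M))%:E)%E; last by rewrite gM gNM subee.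
have dgM : derivable_oo_LRcontinuous g (- M) M.
  split=> [x _||]; first exact: dg.
    by apply: cvg_at_right_filter; exact: cg0.
  by apply: cvg_at_left_filter; exact: cg0.
apply: continuous_FTC2 dgM _; first by rewrite gtrN.
  exact: continuous_subspaceT.
by move=> x _.
Unshelve. all: by end_near. Qed.

Lemma derive_eq0_outside K g : closed K -> (forall p, ~ K p -> g p = 0) ->
  forall p v, ~ K p -> 'D_v g p = 0.
Proof.
move=> cK g0 p v Kp; rewrite -(derive_cst (0 : R) p v).
apply: near_eq_derive; near=> q; apply: g0; near: q.
by apply: (open_nbhs_nbhs (A := ~` K)); split=> //; exact: closed_openC.
Unshelve. all: by end_near. Qed.

(** Fubini's theorem reduces this to lines parallel to the axes, where the
    fundamental theorem of calculus applies between two points outside the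
    support. *)
Lemma integral_pd_eq0 K g : compact K -> Ck 1 setT g ->
  (forall p, ~ K p -> g p = 0) ->
  \int[mu2]_(p in K) pdx g p = 0 /\ \int[mu2]_(p in K) pdy g p = 0.
Proof.
move=> cK Cg g0; have clK := compact_closed (@norm_hausdorff _ _) cK.
have [N N0 KN] := compact_box cK.
have g0N x y : N < `|x| \/ N < `|y| -> g (x, y) = 0.
  move=> xy; apply: g0 => /KN []; rewrite /= !in_itv/= -!ler_norml !leNgt.
  by case: xy => ->.
have mK := compact_measurable2 cK.
have cD v p : {for p, continuous (fun p => 'D_v g p)}.
  exact: Ck_continuous (CkS_derive v Cg) (I : [set: R * R] p).
have CgD (v p : R * R) : is_derive p v g ('D_v g p).
  exact: CkS_is_derive Cg (I : [set: R * R] p).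
have iD v : mu2.-integrable setT (EFin \o (fun p => 'D_v g p)).
  rewrite (_ : EFin \o _ = ((EFin \o (fun p => 'D_v g p)) \_ K)); last first.
    apply/funext => p; rewrite patchE; case: ifPn => //= /negP pK.
    rewrite (derive_eq0_outside clK g0)// => Kp; apply: pK; exact: mem_set.
  apply/(integrable_mkcond _ mK).
  by apply: (@compact_integrable2 _ _ setT) => //; exact: openT.
have mk v : \int[mu2]_(p in K) 'D_v g p = fine (\int[mu2]_p ('D_v g p)%:E)%E.
  rewrite Rintegral_mkcond /Rintegral; congr fine; apply: eq_integral => p _.
  rewrite patchE; case: ifPn => //= /negP pK.
  rewrite (derive_eq0_outside clK g0)// => Kp; apply: pK; exact: mem_set.
have hline y (x t : R) : (t *: (1 : R) + x, y) = t *: ((1, 0) : R * R) + (x, y).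
  by congr pair => /=; rewrite scaler0 add0r.
have vline x (y t : R) : (x, t *: (1 : R) + y) = t *: ((0, 1) : R * R) + (x, y).
  by congr pair => /=; rewrite scaler0 add0r.
rewrite /pdx /pdy !mk; split.
  rewrite -(integral21_prod_meas1 (iD _)).
  rewrite (eq_integral (fun=> 0%E)) ?integral0// => y _.
  rewrite /fubini_G /=.
  have E x : 'D_((1, 0) : R * R) g (x, y) = derive1 (fun x => g (x, y)) x.
    by rewrite derive1E (derive_affine (i := fun x => (x, y)) _ (hline y x)).
  under eq_integral do rewrite E.
  apply: (@integral_derive_eq0 _ N).
  - move=> x; have Cgx := CgD ((1, 0) : R * R) (x, y).
    by have [] := is_derive_affine (i := fun x => (x, y)) (hline y x) Cgx.
  - rewrite -(funext E) => x.
    have cl : {for x, continuous (fun x : R => (x, y))}.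
      apply: (@cvg_pair _ _ _ (nbhs x) (nbhs x) (nbhs y) _ _ _ id (cst y)).
        exact: cvg_id.
      exact: cvg_cst.
    exact: (@continuous_comp _ _ _ (fun x : R => (x, y)) _ x cl (cD _ _)).
  - by move=> x Nx; apply: g0N; left.
rewrite -(integral12_prod_meas1 (iD _)).
rewrite (eq_integral (fun=> 0%E)) ?integral0// => x _.
rewrite /fubini_F /=.
have E y : 'D_((0, 1) : R * R) g (x, y) = derive1 (fun y => g (x, y)) y.
  by rewrite derive1E (derive_affine (i := fun y => (x, y)) _ (vline x y)).
under eq_integral do rewrite E.
apply: (@integral_derive_eq0 _ N).
- move=> y; have Cgy := CgD ((0, 1) : R * R) (x, y).
  by have [] := is_derive_affine (i := fun y => (x, y)) (vline x y) Cgy.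
- rewrite -(funext E) => y.
  have cl : {for y, continuous (fun y : R => (x, y))}.
    apply: (@cvg_pair _ _ _ (nbhs y) (nbhs x) (nbhs y) _ _ _ (cst x) id).
      exact: cvg_cst.
    exact: cvg_id.
  exact: (@continuous_comp _ _ _ (fun y : R => (x, y)) _ y cl (cD _ _)).
- by move=> y Ny; apply: g0N; right.
Qed.

(** The extension of the field by zero is C^1 on [W], where the field vanishes
    outside [K], and on the complement of [K], where it is zero.  These open sets
    cover the plane because [K] lies in [W], whatever the boundary of [K]. *)
Lemma integral_div_eq0 K W (g1 g2 : R * R -> R) :
  compact K -> open W -> K `<=` W -> Ck 1 W g1 -> Ck 1 W g2 ->
  (forall p, W p -> ~ K p -> g1 p = 0) ->
  (forall p, W p -> ~ K p -> g2 p = 0) ->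
  \int[mu2]_(p in K) (pdx g1 p + pdy g2 p) = 0.
Proof.
move=> cK oW KW C1 C2 z1 z2.
have clK := compact_closed (@norm_hausdorff _ _) cK.
pose ext (g : R * R -> R) p := if `[< K p >] then g p else 0.
have extE g : (forall p, W p -> ~ K p -> g p = 0) -> {in W, g =1 ext g}.
  by move=> z p /set_mem Wp; rewrite /ext; case: asboolP => // /z ->.
have Cext g : Ck 1 W g -> (forall p, W p -> ~ K p -> g p = 0) ->
    Ck 1 setT (ext g).
  move=> Cg z; rewrite (_ : setT = W `|` ~` K); last first.
    apply/esym/seteqP; split=> // p _.
    by case: (pselect (K p)) => [/KW|]; [left|right].
  apply: Ck_setU; first exact: Ck_eq (extE _ z) Cg.
  apply: Ck_eq (Ck_cst _ _ 0); first exact: closed_openC.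
  by move=> p /set_mem Kp; rewrite /ext asboolF.
have ext0 g p : ~ K p -> ext g p = 0 by move=> Kp; rewrite /ext asboolF.
have near_ext g : (forall p, W p -> ~ K p -> g p = 0) ->
    forall p v, p \in K -> 'D_v g p = 'D_v (ext g) p.
  move=> z p v /set_mem/KW Wp; apply: near_eq_derive; near=> q.
  by apply: extE => //; apply: mem_set; near: q; exact: open_nbhs_nbhs.
transitivity (\int[mu2]_(p in K) (pdx (ext g1) p + pdy (ext g2) p)).
  by apply: eq_Rintegral => p Kp; rewrite /pdx /pdy (near_ext g1)// (near_ext g2).
have cD g v : Ck 1 setT g -> mu2.-integrable K (EFin \o (fun p => 'D_v g p)).
  move=> Cg; apply: (compact_integrable2 cK openT) => // p _.
  exact: Ck_continuous (CkS_derive v Cg) (I : [set: R * R] p).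
rewrite RintegralD//; [|exact: compact_measurable2|exact/cD/Cext..].
have [-> _] := integral_pd_eq0 cK (Cext _ C1 z1) (@ext0 g1).
have [_ ->] := integral_pd_eq0 cK (Cext _ C2 z2) (@ext0 g2).
by rewrite addr0.
Unshelve. all: by end_near. Qed.

End Divergence.

(** * The first variation of the energy *)

Section TaylorBounds.
Context {R : realType}.

Lemma MVT_bound (f df : R -> R) (a b C : R) :
  (forall t, `|t - a| <= `|b - a| -> is_derive t (1 : R) f (df t)) ->
  (forall t, `|t - a| <= `|b - a| -> `|df t| <= C) ->
  `|f b - f a| <= C * `|b - a|.
Proof.
move=> fdf dfC.
have mvt x y : x <= y -> (forall t, t \in `[x, y] -> `|t - a| <= `|b - a|) ->
    `|f y - f x| <= C * `|y - x|.
  move=> xy xyP.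
  have fc : {within `[x, y], continuous f}.
    by apply: derivable_within_continuous => t /xyP /fdf[].
  have fd t : t \in `]x, y[ -> is_derive t (1 : R) f (df t).
    by move=> tI; apply/fdf/xyP; exact: subset_itv_oo_cc.
  have [c cI ->] := MVT_segment xy fd fc.
  by rewrite normrM ler_wpM2r// dfC// xyP.
have [ab|ba] := leP a b.
  apply: mvt => // t; rewrite in_itv/= => /andP[a_t tb].
  by rewrite !ger0_norm; lra.
rewrite distrC [`|b - a|]distrC; apply: mvt (ltW ba) _ => t.
rewrite in_itv/= => /andP[bt ta].
by rewrite distrC [`|b - a|]distrC !ger0_norm; lra.
Qed.

Lemma taylor1_bound (A : R -> R) (r : R) : Ck 2 setT A ->
  exists2 C, 0 < C & forall t t', `|t| <= r -> `|t'| <= r ->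
    [/\ `|A t| <= C, `|A t' - A t| <= C * `|t' - t| &
        `|A t' - A t - 'D_1 A t * (t' - t)| <= C * `|t' - t| ^+ 2].
Proof.
move=> CA; have CA1 := CkS_derive (1 : R) CA; have CA2 := CkS_derive (1 : R) CA1.
(* the points at distance at most |t' - t| from t may leave [-r, r] *)
pose r3 := 3 * r.
have bnd (g : R -> R) : Ck 0 setT g ->
    exists2 C, 0 < C & forall t, `|t| <= r3 -> `|g t| <= C.
  move=> Cg; have [|C C0 CP] := @compact_bound R _ `[- r3, r3]%classic setT g
      (@segment_compact _ _ _) (@subsetT _ _).
    by move=> t _; exact: Ck_continuous Cg (I : [set: R] t).
  by exists C => // t tr; apply: CP; rewrite /= in_itv/= -ler_norml.
have [C0 C0gt0 C0P] := bnd A (Ck_le (isT : (0 <= 2)%N) CA).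
have [C1 C1gt0 C1P] := bnd _ (Ck_le (isT : (0 <= 1)%N) CA1).
have [C2 C2gt0 C2P] := bnd _ CA2.
have dA (t : R) : is_derive t (1 : R) A ('D_1 A t).
  exact: CkS_is_derive CA (I : [set: R] t).
have dA1 (t : R) :
    is_derive t (1 : R) (fun t => 'D_1 A t) ('D_1 (fun t => 'D_1 A t) t).
  exact: CkS_is_derive CA1 (I : [set: R] t).
exists (C0 + C1 + C2) => [|t t' tr tr']; first by rewrite !addr_gt0.
have d0 := normr_ge0 (t' - t).
have dr : `|t' - t| <= r + r by rewrite (le_trans (ler_normB _ _))// lerD.
have near3 x : `|x - t| <= `|t' - t| -> `|x| <= r3.
  move=> xt; rewrite -(subrK t x) (le_trans (ler_normD _ _))// /r3; lra.
have e1 x : `|x - t| <= `|t' - t| -> `|'D_1 A x - 'D_1 A t| <= C2 * `|t' - t|.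
  move=> xt; apply: (@le_trans _ _ (C2 * `|x - t|)).
    apply: MVT_bound (fun z _ => dA1 z) _ => z zx.
    by apply/C2P/near3/(le_trans zx).
  by rewrite ler_wpM2l// ltW.
split.
- by rewrite (le_trans (C0P _ _)) ?near3 ?subrr ?normr0//; lra.
- apply: (@le_trans _ _ (C1 * `|t' - t|)); last by rewrite ler_wpM2r//; lra.
  by apply: MVT_bound (fun z _ => dA z) _ => z /near3 /C1P.
(* subtracting the linear part leaves a derivative that vanishes at t *)
pose g (x : R) := A x - 'D_1 A t * x.
have dg x : is_derive x (1 : R) g ('D_1 A x - 'D_1 A t).
  have dl : is_derive x (1 : R) (fun x : R => 'D_1 A t * x) ('D_1 A t).
    have dZ := @is_deriveZ _ _ _ id ('D_1 A t) x 1 1 (is_derive_id x (1 : R)).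
    by apply: is_derive_eq dZ _; exact: mulr1.
  exact: is_deriveB (dA x) dl.
have -> : A t' - A t - 'D_1 A t * (t' - t) = g t' - g t by rewrite /g; ring.
apply: le_trans (MVT_bound (fun z _ => dg z) e1) _.
by rewrite expr2 mulrA !ler_wpM2r//; lra.
Qed.

End TaylorBounds.

Section QuadraticRemainder.
Context {R : realType}.

Lemma is_derive_quadratic (E : R -> R) (r C : R) : 0 < r ->
  (forall s, `|s| <= r -> `|E s - E 0| <= C * s ^+ 2) ->
  is_derive (0 : R) (1 : R) E 0.
Proof.
move=> r0 EC.
have lim0 : (fun h : R => h^-1 *: ((E \o shift 0) (h *: (1 : R)) - E 0)) @ 0^'
    --> (0 : R).
  apply: (@cvg_to_0_linear _ _ C r r0) => h /andP[h0 hr].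
  rewrite /= addr0 [_%:A]mulr1 normrM normrV ?unitfE -?normr_gt0//.
  rewrite ler_pdivrMl//; apply: (le_trans (EC h (ltW hr))).
  by rewrite -real_normK ?num_real// expr2 mulrCA.
apply: DeriveDef; first by apply/cvg_ex; exists 0.
exact: (cvg_lim (@Rhausdorff R) lim0).
Qed.

(** Here [a], [b] and [a'] stand for [A (R)], [A (R_w)] and [A' (R)], [r] for
    [R_w - R], and [X], [Y], [X'], [Y'] for the partial derivatives of a
    component of the map before and after the variation.  The bounded quantity is
    the increment of one term of the energy density minus its linear part; it
    equals
    [(b - a - a' r) (X^2 + Y^2) + 2 (b - a) (X dX + Y dY) + b (dX^2 + dY^2)],
    in which every summand is of second order. *)
Lemma quadratic_remainder (C d a a' X Y b r X' Y' : R) : 0 <= d ->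
  `|b| <= C -> `|b - a| <= C * `|r| -> `|b - a - a' * r| <= C * `|r| ^+ 2 ->
  `|X| <= C -> `|Y| <= C ->
  `|r| <= C * d -> `|X' - X| <= C * d -> `|Y' - Y| <= C * d ->
  `|b * (X' ^+ 2 + Y' ^+ 2) - a * (X ^+ 2 + Y ^+ 2)
    - (a' * r * (X ^+ 2 + Y ^+ 2) + 2 * a * (X * (X' - X) + Y * (Y' - Y)))|
  <= (2 * C ^+ 5 + 4 * C ^+ 4 + 2 * C ^+ 3) * d ^+ 2.
Proof.
move=> d0 bC baC baaC XC YC rC xC yC.
have C0 : 0 <= C := le_trans (normr_ge0 _) bC.
have Cd0 : 0 <= C * d by rewrite mulr_ge0.
have sq (z k : R) : 0 <= k -> `|z| <= k -> `|z ^+ 2| <= k ^+ 2.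
  by move=> k0 zk; rewrite normrX lerXn2r// nnegrE.
have mul (z k w l : R) : `|z| <= k -> `|w| <= l -> `|z * w| <= k * l.
  by move=> zk wl; rewrite normrM ler_pM.
have add (z k w l : R) : `|z| <= k -> `|w| <= l -> `|z + w| <= k + l.
  by move=> zk wl; rewrite (le_trans (ler_normD _ _))// lerD.
have -> : b * (X' ^+ 2 + Y' ^+ 2) - a * (X ^+ 2 + Y ^+ 2)
    - (a' * r * (X ^+ 2 + Y ^+ 2) + 2 * a * (X * (X' - X) + Y * (Y' - Y))) =
    (b - a - a' * r) * (X ^+ 2 + Y ^+ 2)
    + 2 * (b - a) * (X * (X' - X) + Y * (Y' - Y))
    + b * ((X' - X) ^+ 2 + (Y' - Y) ^+ 2) by ring.
have -> : (2 * C ^+ 5 + 4 * C ^+ 4 + 2 * C ^+ 3) * d ^+ 2 =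
    C * (C * d) ^+ 2 * (C ^+ 2 + C ^+ 2)
    + 2 * (C * (C * d)) * (C * (C * d) + C * (C * d))
    + C * ((C * d) ^+ 2 + (C * d) ^+ 2) by ring.
have Xx := mul _ _ _ _ XC xC; have Yy := mul _ _ _ _ YC yC.
have XY := add _ _ _ _ (sq _ _ C0 XC) (sq _ _ C0 YC).
have xy := add _ _ _ _ (sq _ _ Cd0 xC) (sq _ _ Cd0 yC).
have ba : `|2 * (b - a)| <= 2 * (C * (C * d)).
  by rewrite normrM ger0_norm// ler_pM2l// (le_trans baC)// ler_wpM2l.
have bar : `|b - a - a' * r| <= C * (C * d) ^+ 2.
  by apply: (le_trans baaC); rewrite ler_wpM2l// lerXn2r// nnegrE.
exact: add _ _ _ _ (add _ _ _ _ (mul _ _ _ _ bar XY)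
  (mul _ _ _ _ ba (add _ _ _ _ Xx Yy))) (mul _ _ _ _ bC xy).
Qed.

End QuadraticRemainder.

Section VariationBounds.
Context {R : realType}.
Implicit Types (W K : set (R * R)) (H : R * (R * R) -> R) (w : R * R -> R).

Let tube (e : R) W := [set q : R * (R * R) | `|q.1| < e /\ W q.2].

(** The derivative in [s] is bounded on the compact set [[-e/2, e/2] x K]. *)
Lemma tube_lipschitz W K (e : R) H : 0 < e -> compact K -> K `<=` W ->
  Ck 1 (tube e W) H -> exists2 C, 0 < C & forall s p, `|s| <= e / 2 -> K p ->
    `|H (s, p) - H (0, p)| <= C * `|s|.
Proof.
move=> e0 cK KW CH.
pose I : set R := `[- (e / 2), e / 2]%classic.
have inI (s : R) : `|s| <= e / 2 -> I s by rewrite /I /= in_itv/= ler_norml.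
have [|||C C0 CP] := @compact_bound R _ (I `*` K) (tube e W)
    (fun q => 'D_((1, 0) : R * (R * R)) H q).
- by apply: compact_setX => //; exact: segment_compact.
- move=> [s p] [/= sI Kp]; split; last exact: KW.
  move: sI; rewrite /I /= in_itv/= -ler_norml => /le_lt_trans; apply; lra.
- by move=> q Dq; exact: Ck_continuous (CkS_derive _ CH) Dq.
exists C => // s p se Kp.
have line (t k : R) :
    (k *: (1 : R) + t, p) = k *: ((1, 0) : R * (R * R)) + (t, p).
  by congr pair => /=; rewrite scaler0 add0r.
rewrite -[X in C * `|X|]subr0.
apply: (MVT_bound (f := fun t => H (t, p))
  (df := fun t => 'D_((1, 0) : R * (R * R)) H (t, p))) => t; rewrite !subr0 => ts.
- apply: (is_derive_affine (i := fun t : R => (t, p)) (line t)).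
  apply: CkS_is_derive CH _; split; last exact: KW.
  rewrite /= (le_lt_trans ts)// (le_lt_trans se)//; lra.
- by apply: CP; split=> //; apply: inI; exact: le_trans se.
Qed.

Lemma slice_line (s : R) (p v : R * R) (t : R) :
  (s, t *: v + p) = t *: ((0, v) : R * (R * R)) + (s, p).
Proof. by congr pair => /=; rewrite scaler0 add0r. Qed.

Lemma Ck_slice n W (e s : R) H : open W -> `|s| < e -> Ck n (tube e W) H ->
  Ck n W (fun p => H (s, p)).
Proof.
move=> oW se; apply: (@Ck_affine _ _ _ _ W (tube e W) (fun p => (s, p)) H
  (fun v => (0, v)) oW) => [p|p Wp|p v t]; last exact: slice_line.
- apply: (@cvg_pair _ _ _ (nbhs p) (nbhs s) (nbhs p) _ _ _ (cst s) id).
    exact: cvg_cst.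
  exact: cvg_id.
- by split.
Qed.

(** The partial derivatives of a slice are slices of directional derivatives of
    [H], hence Lipschitz in [s] for the same reason as [H] itself. *)
Lemma variation_bound W K (e : R) H w : 0 < e -> open W -> compact K ->
  K `<=` W -> Ck 2 (tube e W) H -> (forall p, W p -> H (0, p) = w p) ->
  exists2 C, 0 < C & forall s p, `|s| <= e / 2 -> K p ->
    [/\ `|H (s, p) - w p| <= C * `|s|,
        `|pdx (fun p => H (s, p)) p - pdx w p| <= C * `|s| &
        `|pdy (fun p => H (s, p)) p - pdy w p| <= C * `|s| ].
Proof.
move=> e0 oW cK KW CH H0.
have [C0 C00 C0P] := tube_lipschitz e0 cK KW (Ck_pred CH).
have [C1 C10 C1P] := tube_lipschitz e0 cK KW
  (CkS_derive ((0, (1, 0)) : R * (R * R)) CH).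
have [C2 C20 C2P] := tube_lipschitz e0 cK KW
  (CkS_derive ((0, (0, 1)) : R * (R * R)) CH).
have slice s p (v : R * R) : 'D_v (fun p => H (s, p)) p = 'D_(0, v) H (s, p).
  exact: (derive_affine (i := fun p => (s, p)) H (slice_line s p v)).
have w0 p (v : R * R) : K p -> 'D_v w p = 'D_v (fun p => H (0, p)) p.
  move=> /KW Wp; apply: near_eq_derive; near=> q; apply/esym/H0.
  by near: q; exact: open_nbhs_nbhs.
exists (C0 + C1 + C2) => [|s p se Kp]; first by rewrite !addr_gt0.
have s0 := normr_ge0 s.
split.
- rewrite -H0; last exact: KW.
  by rewrite (le_trans (C0P _ _ se Kp))// ler_wpM2r//; lra.
- rewrite /pdx w0// !slice.
  by rewrite (le_trans (C1P _ _ se Kp))// ler_wpM2r//; lra.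
- rewrite /pdy w0// !slice.
  by rewrite (le_trans (C2P _ _ se Kp))// ler_wpM2r//; lra.
Unshelve. all: by end_near. Qed.

End VariationBounds.

Section FirstVariation.
Context {R : realType}.
Local Notation mu := (@lebesgue_measure R).
Local Notation mu2 := (@product_measure1 _ _ _ _ R mu mu).
Implicit Types (W K : set (R * R)) (u : R * R -> R * R) (A B : R -> R).

Definition energy_density A B u (p : R * R) : R :=
  A (cR u p) * (pdx (cR u) p ^+ 2 + pdy (cR u) p ^+ 2) +
  B (cR u p) * (pdx (cS u) p ^+ 2 + pdy (cS u) p ^+ 2).

(** The first equation is multiplied by 2 to avoid a division. *)
Definition euler_lagrange A B u (p : R * R) : Prop :=
  2 * (pdx (fun q => A (cR u q) * pdx (cR u) q) p +
       pdy (fun q => A (cR u q) * pdy (cR u) q) p) =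
    'D_1 A (cR u p) * (pdx (cR u) p ^+ 2 + pdy (cR u) p ^+ 2) +
    'D_1 B (cR u p) * (pdx (cS u) p ^+ 2 + pdy (cS u) p ^+ 2) /\
  pdx (fun q => B (cR u q) * pdx (cS u) q) p +
  pdy (fun q => B (cR u q) * pdy (cS u) q) p = 0.

Lemma Ck_energy_density A B u W : open W -> Ck 2 setT A -> Ck 2 setT B ->
  Ck 1 W (cR u) -> Ck 1 W (cS u) -> Ck 0 W (energy_density A B u).
Proof.
move=> oW CA CB CR CS.
have sq (w : R * R -> R) : Ck 1 W w ->
    Ck 0 W (fun p => pdx w p ^+ 2 + pdy w p ^+ 2).
  move=> Cw; exact: Ck_add oW (Ck_sqr oW (CkS_derive _ Cw))
    (Ck_sqr oW (CkS_derive _ Cw)).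
have Cc (g : R -> R) : Ck 2 setT g -> Ck 0 W (fun p => g (cR u p)).
  by move=> Cg; exact: Ck_comp oW (Ck_pred (Ck_pred Cg)) (Ck_pred CR).
exact: Ck_add oW (Ck_mul oW (Cc _ CA) (sq _ CR)) (Ck_mul oW (Cc _ CB) (sq _ CS)).
Qed.

Lemma derive_mul_add W (g1 g2 r1 r2 : R * R -> R) (v p : R * R) : open W ->
  Ck 1 W g1 -> Ck 1 W r1 -> Ck 1 W g2 -> Ck 1 W r2 -> W p ->
  'D_v (fun q => g1 q * r1 q + g2 q * r2 q) p =
  g1 p * 'D_v r1 p + r1 p * 'D_v g1 p + (g2 p * 'D_v r2 p + r2 p * 'D_v g2 p).
Proof.
move=> oW C1 D1 C2 D2 Wp.
have M (g r : R * R -> R) : Ck 1 W g -> Ck 1 W r ->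
    'D_v (fun q => g q * r q) p = g p * 'D_v r p + r p * 'D_v g p.
  by move=> Cg Cr; exact: deriveM (CkS_derivable Cg Wp) (CkS_derivable Cr Wp).
rewrite -(M _ _ C1 D1) -(M _ _ C2 D2).
exact: deriveD (CkS_derivable (Ck_mul oW C1 D1) Wp)
  (CkS_derivable (Ck_mul oW C2 D2) Wp).
Qed.

Lemma pd_sub W (g1 g2 : R * R -> R) (v p : R * R) : Ck 1 W g1 -> Ck 1 W g2 ->
  W p -> 'D_v (fun q => g1 q - g2 q) p = 'D_v g1 p - 'D_v g2 p.
Proof.
move=> C1 C2 Wp.
exact: (deriveB (CkS_derivable C1 Wp) (CkS_derivable C2 Wp)).
Qed.

(** In the left-hand side the last factor is [div V] for the field [V] of the
    next proof, expanded by the product rule; [r], [s] are the increments of the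
    two components, [a], [b] the coefficients of the metric and [P1x], ..., [Q2y]
    the derivatives of [A R_x], [A R_y], [B S_x], [B S_y].  The equations turn
    the terms of [div V] that contain no derivative of [r] and [s] into
    the variation of the coefficients [A (R)] and [B (R)]. *)
Lemma first_order_terms (a b a' b' X Y S T r s rx ry sx sy : R)
    (P1x Q1y P2x Q2y Aw Au Bw Bu : R) :
  2 * (P1x + Q1y) = a' * (X ^+ 2 + Y ^+ 2) + b' * (S ^+ 2 + T ^+ 2) ->
  P2x + Q2y = 0 ->
  Aw + Bw - (Au + Bu) - 2 *
    (a * X * rx + r * P1x + (b * S * sx + s * P2x) +
    (a * Y * ry + r * Q1y + (b * T * sy + s * Q2y))) =
  (Aw - Au - (a' * r * (X ^+ 2 + Y ^+ 2) + 2 * a * (X * rx + Y * ry))) +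
  (Bw - Bu - (b' * r * (S ^+ 2 + T ^+ 2) + 2 * b * (S * sx + T * sy))).
Proof.
move=> e1 e2.
have -> : a' * r * (X ^+ 2 + Y ^+ 2) =
    r * (2 * (P1x + Q1y)) - b' * r * (S ^+ 2 + T ^+ 2) by rewrite e1; ring.
have -> : Q2y = - P2x by apply/eqP; rewrite -addr_eq0 addrC e2.
ring.
Qed.

(** The two quantities bounded by [Q] are the increments of the two terms of the
    energy density minus their linear parts.  The linear parts add up to twice the
    divergence of [V = (R_w - R) A grad R + (S_w - S) B grad S], which vanishes
    outside [K] and therefore contributes nothing to the energy. *)
Lemma energy_variation_bound A B u w W K :
  Ck 2 setT A -> Ck 2 setT B -> open W -> compact K -> K `<=` W ->
  Ck 2 W (cR u) -> Ck 2 W (cS u) -> Ck 2 W (cR w) -> Ck 2 W (cS w) ->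
  (forall p, W p -> euler_lagrange A B u p) ->
  (forall p, W p -> ~ K p -> w p = u p) ->
  forall Q : R, (forall p, K p ->
    `|A (cR w p) * (pdx (cR w) p ^+ 2 + pdy (cR w) p ^+ 2)
      - A (cR u p) * (pdx (cR u) p ^+ 2 + pdy (cR u) p ^+ 2)
      - ('D_1 A (cR u p) * (cR w p - cR u p) *
           (pdx (cR u) p ^+ 2 + pdy (cR u) p ^+ 2)
         + 2 * A (cR u p) * (pdx (cR u) p * (pdx (cR w) p - pdx (cR u) p)
              + pdy (cR u) p * (pdy (cR w) p - pdy (cR u) p)))| <= Q /\
    `|B (cR w p) * (pdx (cS w) p ^+ 2 + pdy (cS w) p ^+ 2)
      - B (cR u p) * (pdx (cS u) p ^+ 2 + pdy (cS u) p ^+ 2)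
      - ('D_1 B (cR u p) * (cR w p - cR u p) *
           (pdx (cS u) p ^+ 2 + pdy (cS u) p ^+ 2)
         + 2 * B (cR u p) * (pdx (cS u) p * (pdx (cS w) p - pdx (cS u) p)
              + pdy (cS u) p * (pdy (cS w) p - pdy (cS u) p)))| <= Q) ->
  `|\int[mu2]_(p in K) energy_density A B w p -
    \int[mu2]_(p in K) energy_density A B u p| <= 2 * Q * fine (mu2 K).
Proof.
move=> CA CB oW cK KW CRu CSu CRw CSw EL wu Q QP.
have mK := compact_measurable2 cK.
pose rho p := cR w p - cR u p; pose sig p := cS w p - cS u p.
pose P1 q := A (cR u q) * pdx (cR u) q; pose Q1 q := A (cR u q) * pdy (cR u) q.
pose P2 q := B (cR u q) * pdx (cS u) q; pose Q2 q := B (cR u q) * pdy (cS u) q.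
pose V1 q := P1 q * rho q + P2 q * sig q.
pose V2 q := Q1 q * rho q + Q2 q * sig q.
have Ccomp (g : R -> R) : Ck 2 setT g -> Ck 1 W (fun p => g (cR u p)).
  by move=> Cg; exact: Ck_comp oW (Ck_pred Cg) (Ck_pred CRu).
have Crho : Ck 1 W rho := Ck_sub oW (Ck_pred CRw) (Ck_pred CRu).
have Csig : Ck 1 W sig := Ck_sub oW (Ck_pred CSw) (Ck_pred CSu).
have CP1 : Ck 1 W P1 := Ck_mul oW (Ccomp _ CA) (CkS_derive _ CRu).
have CQ1 : Ck 1 W Q1 := Ck_mul oW (Ccomp _ CA) (CkS_derive _ CRu).
have CP2 : Ck 1 W P2 := Ck_mul oW (Ccomp _ CB) (CkS_derive _ CSu).
have CQ2 : Ck 1 W Q2 := Ck_mul oW (Ccomp _ CB) (CkS_derive _ CSu).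
have CV1 : Ck 1 W V1 := Ck_add oW (Ck_mul oW CP1 Crho) (Ck_mul oW CP2 Csig).
have CV2 : Ck 1 W V2 := Ck_add oW (Ck_mul oW CQ1 Crho) (Ck_mul oW CQ2 Csig).
have V0 p : W p -> ~ K p -> rho p = 0 /\ sig p = 0.
  by move=> Wp Kp; rewrite /rho /sig /cR /cS wu// !subrr.
have div0 : \int[mu2]_(p in K) (pdx V1 p + pdy V2 p) = 0.
  apply: (integral_div_eq0 cK oW KW CV1 CV2) => p Wp Kp.
    by rewrite /V1; have [-> ->] := V0 p Wp Kp; rewrite !mulr0 addr0.
  by rewrite /V2; have [-> ->] := V0 p Wp Kp; rewrite !mulr0 addr0.
have iK (g : R * R -> R) : Ck 0 W g -> mu2.-integrable K (EFin \o g).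
  move=> Cg; apply: (compact_integrable2 cK oW KW) => p Wp.
  exact: Ck_continuous Cg Wp.
have Cdu : Ck 0 W (energy_density A B u).
  exact: Ck_energy_density oW CA CB (Ck_pred CRu) (Ck_pred CSu).
have Cdw : Ck 0 W (energy_density A B w).
  exact: Ck_energy_density oW CA CB (Ck_pred CRw) (Ck_pred CSw).
have Cdiv : Ck 0 W (fun p => pdx V1 p + pdy V2 p).
  exact: Ck_add oW (CkS_derive _ CV1) (CkS_derive _ CV2).
have Cd2 : Ck 0 W (fun p => 2 * (pdx V1 p + pdy V2 p)).
  exact: Ck_mul oW (Ck_cst _ _ _) Cdiv.
have Cdd := Ck_sub oW Cdw Cdu.
pose rem p := energy_density A B w p - energy_density A B u p
  - 2 * (pdx V1 p + pdy V2 p).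
have Crem : Ck 0 W rem := Ck_sub oW Cdd Cd2.
have -> : \int[mu2]_(p in K) energy_density A B w p -
    \int[mu2]_(p in K) energy_density A B u p = \int[mu2]_(p in K) rem p.
  rewrite /rem RintegralB//; [|exact: iK|exact: iK].
  rewrite RintegralB//; [|exact: iK|exact: iK].
  by rewrite RintegralZl//; [|exact: iK]; rewrite div0 mulr0 subr0.
have remQ p : K p -> `|rem p| <= 2 * Q.
  move=> Kp; have Wp := KW _ Kp; have [QA QB] := QP p Kp.
  have [EL1 EL2] := EL p Wp.
  have drho v : 'D_v rho p = 'D_v (cR w) p - 'D_v (cR u) p.
    exact: pd_sub (Ck_pred CRw) (Ck_pred CRu) Wp.
  have dsig v : 'D_v sig p = 'D_v (cS w) p - 'D_v (cS u) p.
    exact: pd_sub (Ck_pred CSw) (Ck_pred CSu) Wp.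
  have dV1 : pdx V1 p = P1 p * pdx rho p + rho p * pdx P1 p
      + (P2 p * pdx sig p + sig p * pdx P2 p).
    exact: derive_mul_add oW CP1 Crho CP2 Csig Wp.
  have dV2 : pdy V2 p = Q1 p * pdy rho p + rho p * pdy Q1 p
      + (Q2 p * pdy sig p + sig p * pdy Q2 p).
    exact: derive_mul_add oW CQ1 Crho CQ2 Csig Wp.
  have -> : 2 * Q = Q + Q by ring.
  apply: le_trans (lerD QA QB); apply: le_trans (ler_normD _ _).
  rewrite le_eqVlt; apply/orP; left; apply/eqP; congr (`|_|).
  rewrite /rem dV1 dV2 /pdx /pdy !drho !dsig.
  exact: first_order_terms EL1 EL2.
apply: (le_trans (le_normr_Rintegral mK (iK _ Crem))).
rewrite -Rintegral_cst//; apply: le_Rintegral => //.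
- have Ca := iK _ Crem; rewrite (_ : EFin \o _ = abse \o (EFin \o rem))//.
  exact: integrable_abse.
- exact: iK (Ck_cst _ _ _).
Qed.

End FirstVariation.

Section Stationarity.
Context {R : realType}.
Local Notation mu := (@lebesgue_measure R).
Local Notation mu2 := (@product_measure1 _ _ _ _ R mu mu).
Implicit Types (W K : set (R * R)) (u : R * R -> R * R) (A B : R -> R).

(** On [K] the values of [R] stay, for [|s| <= e/2], in a bounded interval
    [[-r, r]], on which [A] and [B] have second-order Taylor bounds; the remainder
    of [energy_variation_bound] is then at most a constant times [s^2]. *)
Lemma energy_stationary f A B (J : set R) W K u (e : R) h :
  Ck 2 setT A -> Ck 2 setT B -> open W -> Ck 2 W (cR u) -> Ck 2 W (cS u) ->
  (forall p, W p -> euler_lagrange A B u p) ->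
  compact K -> K `<=` W -> 0 < e -> compact_variation J W K u e h ->
  is_derive (0 : R) (1 : R) (fun s => energy f A B K (h s)) 0.
Proof.
move=> CA CB oW CRu CSu EL cK KW e0 [/(_ 2%N) CR /(_ 2%N) CS _ h0 hK].
have e2 (s : R) : `|s| <= e / 2 -> `|s| < e by move=> /le_lt_trans; apply; lra.
have [C1 C10 C1P] := variation_bound e0 oW cK KW CR
  (fun p Wp => congr1 fst (h0 p Wp)).
have [C2 C20 C2P] := variation_bound e0 oW cK KW CS
  (fun p Wp => congr1 snd (h0 p Wp)).
have bnd (g : R * R -> R) : Ck 0 W g ->
    exists2 C, 0 < C & forall p, K p -> `|g p| <= C.
  by move=> Cg; apply: (compact_bound cK KW) => p Wp; exact: Ck_continuous Cg Wp.
have [M M0 MP] := bnd _ (Ck_pred (Ck_pred CRu)).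
have [C3 C30 C3P] := bnd _ (Ck_pred (CkS_derive ((1, 0) : R * R) CRu)).
have [C4 C40 C4P] := bnd _ (Ck_pred (CkS_derive ((0, 1) : R * R) CRu)).
have [C5 C50 C5P] := bnd _ (Ck_pred (CkS_derive ((1, 0) : R * R) CSu)).
have [C6 C60 C6P] := bnd _ (Ck_pred (CkS_derive ((0, 1) : R * R) CSu)).
pose r := M + C1 * (e / 2).
have [C7 C70 C7P] := taylor1_bound r CA.
have [C8 C80 C8P] := taylor1_bound r CB.
(* one constant for all bounds: every Ci is positive, so C dominates them *)
pose C := C1 + C2 + C3 + C4 + C5 + C6 + C7 + C8.
have leC (x k z : R) : 0 <= z -> k <= C -> x <= k * z -> x <= C * z.
  by move=> z0 kC /le_trans; apply; exact: ler_wpM2r.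
have leC1 (x k : R) : k <= C -> x <= k -> x <= C by move=> ? /le_trans; apply.
have [k1 k2 k3 k4] : [/\ C1 <= C, C2 <= C, C3 <= C & C4 <= C].
  by rewrite /C; clear -C10 C20 C30 C40 C50 C60 C70 C80; split; lra.
have [k5 k6 k7 k8] : [/\ C5 <= C, C6 <= C, C7 <= C & C8 <= C].
  by rewrite /C; clear -C10 C20 C30 C40 C50 C60 C70 C80; split; lra.
pose Q := 2 * C ^+ 5 + 4 * C ^+ 4 + 2 * C ^+ 3.
apply: (@is_derive_quadratic _ _ (e / 2) (2 * Q * fine (mu2 K))); first by lra.
move=> s se; rewrite !energyE.
have -> : \int[mu2]_(p in K) energy_density A B (h 0) p =
    \int[mu2]_(p in K) energy_density A B u p.
  apply: eq_Rintegral => p /set_mem /KW Wp.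
  have near_u : \forall q \near p, h 0 q = u q.
    by near=> q; apply: h0; near: q; exact: open_nbhs_nbhs.
  have pdR (v : R * R) : 'D_v (cR (h 0)) p = 'D_v (cR u) p.
    by apply: near_eq_derive; apply: filterS near_u => q; rewrite /cR => ->.
  have pdS (v : R * R) : 'D_v (cS (h 0)) p = 'D_v (cS u) p.
    by apply: near_eq_derive; apply: filterS near_u => q; rewrite /cS => ->.
  by rewrite /energy_density /pdx /pdy !pdR !pdS /cR h0.
have -> : 2 * Q * fine (mu2 K) * s ^+ 2 = 2 * (Q * `|s| ^+ 2) * fine (mu2 K).
  by rewrite real_normK ?num_real//; ring.
apply: (energy_variation_bound CA CB oW cK KW CRu CSu
  (Ck_slice oW (e2 _ se) CR) (Ck_slice oW (e2 _ se) CS) EL).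
  by move=> p Wp Kp; apply: (hK (s, p)) => //; split=> //; exact: e2.
move=> p Kp; have s0 := normr_ge0 s.
have [r1 x1 y1] := C1P s p se Kp; have [r2 x2 y2] := C2P s p se Kp.
have ur : `|cR u p| <= r.
  by rewrite (le_trans (MP p Kp))// /r lerDl mulr_ge0 ?ltW// divr_gt0.
have wr : `|cR (h s) p| <= r.
  rewrite -(subrK (cR u p) (cR (h s) p)) (le_trans (ler_normD _ _))// /r addrC.
  rewrite lerD ?MP// (le_trans r1)// ler_wpM2l// ltW//.
have [a1 a2 a3] := C7P _ _ ur wr; have [a1' _ _] := C7P _ _ wr ur.
have [b1 b2 b3] := C8P _ _ ur wr; have [b1' _ _] := C8P _ _ wr ur.
split; apply: quadratic_remainder => //.
- exact: leC1 k7 a1'.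
- exact: leC k7 a2.
- by apply: leC k7 a3; exact: sqr_ge0.
- exact: leC1 k3 (C3P p Kp).
- exact: leC1 k4 (C4P p Kp).
- exact: leC k1 r1.
- exact: leC k1 x1.
- exact: leC k1 y1.
- exact: leC1 k8 b1'.
- exact: leC k8 b2.
- by apply: leC k8 b3; exact: sqr_ge0.
- exact: leC1 k5 (C5P p Kp).
- exact: leC1 k6 (C6P p Kp).
- exact: leC k1 r1.
- exact: leC k2 x2.
- exact: leC k2 y2.
Unshelve. all: by end_near. Qed.

End Stationarity.

(** * The map into the ellipsoid *)

Section EllipsoidMap.
Context {R : realType}.
Variables (a b c theta : R).
Hypothesis c1 : 1 < c.
Hypothesis thetaI : 0 < theta < pi / 2.

Local Notation phi := (phase a b c).
Local Notation u := (umap a b c theta).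
Local Notation k := (Num.sqrt (c ^+ 2 - 1)).

(** The linear part of [phi]. *)
Let dphi (v : R * R) : R := (a * v.2 - b * v.1) / k.
(** The derivative of the coordinate [R] with respect to [phi]. *)
Let psi (p : R * R) : R := - (cos theta * cos (phi p)) / sin (cR u p).

Lemma sin_theta_gt0 : 0 < sin theta.
Proof. exact: sin_gt0_pihalf. Qed.

Lemma k_gt0 : 0 < k.
Proof. by rewrite sqrtr_gt0 subr_gt0 expr_gt1// ltW// (lt_trans ltr01). Qed.

Lemma sqr_k : k ^+ 2 = c ^+ 2 - 1.
Proof. by rewrite sqr_sqrtr// ltW// -sqrtr_gt0; exact: k_gt0. Qed.

Lemma cos_theta_sin_lt1 (x : R) : -1 < cos theta * sin x < 1.
Proof.
have s0 := sin_theta_gt0; have t1 := cos2Dsin2 theta; have x1 := cos2Dsin2 x.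
rewrite -ltr_norml -(@ltr_pXn2r _ 2) ?nnegrE// expr1n real_normK ?num_real//.
rewrite exprMn.
have st0 : 0 < sin theta ^+ 2 by rewrite exprn_gt0.
have cx0 : 0 <= cos x ^+ 2 := sqr_ge0 _; have sx0 : 0 <= sin x ^+ 2 := sqr_ge0 _.
have ct0 : 0 <= cos theta ^+ 2 := sqr_ge0 _.
nra.
Qed.

Lemma umap_chart p : 0 < cR u p < pi.
Proof.
have /andP[w1 w2] := cos_theta_sin_lt1 (phi p).
by rewrite acos_gt0 ?acos_ltpi ?w1 ?w2 ?ltW.
Qed.

Lemma sin_cR_gt0 p : 0 < sin (cR u p).
Proof. by apply: sin_gt0_pi; exact: umap_chart. Qed.

Lemma cos_cR p : cos (cR u p) = cos theta * sin (phi p).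
Proof.
have /andP[w1 w2] := cos_theta_sin_lt1 (phi p).
by rewrite /cR/= acosK// in_itv/= !ltW.
Qed.

Lemma phase_affine p v (t : R) : phi (t *: v + p) = t *: dphi v + phi p.
Proof.
rewrite /phase /dphi /= -[t *: (_ / _)]/(t * (_ / _)).
by rewrite -[t *: v.1]/(t * v.1) -[t *: v.2]/(t * v.2); ring.
Qed.

Lemma is_derive_phase p v : is_derive p v phi (dphi v).
Proof.
exact: is_derive_affine (phase_affine p v) (is_derive_id (phi p) (dphi v)).
Qed.

Lemma Ck_phase n (D : set (R * R)) : open D -> Ck n D phi.
Proof.
move=> oD; apply: Ck_eq (Ck_linear n (- (b / k)) (a / k) oD) => // p _.
by rewrite /phase; ring.
Qed.

Lemma is_derive_cR p v : is_derive p v (cR u) (psi p * dphi v).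
Proof.
have wI := cos_theta_sin_lt1 (phi p); have /andP[w1 w2] := wI.
have ds := is_derive_comp1 (is_derive_phase p v) (is_derive_sin (phi p)).
have dw := is_deriveM_fun (is_derive_cst (cos theta) p v) ds.
have dR := is_derive_comp1 dw (is_derive1_acos wI).
apply: is_derive_eq dR _.
by rewrite /psi /cR /= sin_acos ?ltW//= mulr0 addr0; ring.
Qed.

Lemma Ck_psi n (D : set (R * R)) : open D -> Ck n D (cR u) -> Ck n D psi.
Proof.
move=> oD CR; apply: Ck_mul => //.
  apply: Ck_opp => //; apply: Ck_mul (Ck_cst _ _ _) _ => //.
  exact: Ck_comp oD (Ck_sin_cos n).2 (Ck_phase n oD).
apply: Ck_inv (Ck_comp oD (Ck_sin_cos n).1 CR) => // p _.
by rewrite gt_eqF// sin_cR_gt0.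
Qed.

(** The derivative of the coordinate [R] is a function of [sin R] and [phi], so
    that the induction on [n] closes without studying [arccos] beyond its first
    derivative. *)
Lemma Ck_cR n (D : set (R * R)) : open D -> Ck n D (cR u).
Proof.
move=> oD; have cc p : D p -> {for p, continuous (cR u)}.
  move=> Dp; pose w q := cos theta * sin (phi q).
  have cw : {for p, continuous w}.
    apply: Ck_continuous Dp; apply: Ck_mul (Ck_cst 0 _ _) _ => //.
    exact: Ck_comp oD (Ck_sin_cos 0).1 (Ck_phase 0 oD).
  exact: (@continuous_comp _ _ _ w acos p cw
    (continuous_acos (cos_theta_sin_lt1 (phi p)))).
elim: n => [|n IHn]; first by split.
apply: (@CkS_intro _ _ _ _ _ (fun v p => psi p * dphi v)) => //.
- by move=> v p _; exact: is_derive_cR.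
- by move=> v; exact: Ck_mul oD (Ck_psi oD IHn) (Ck_cst _ _ _).
Qed.

(** The derivative of [S - (a x + b y)] with respect to [phi]. *)
Let tau p : R := sin theta / sin (cR u p) ^+ 2.

Lemma is_derive_cS p v : umap_dom a b c p ->
  is_derive p v (cS u) (a * v.1 + b * v.2 + tau p * dphi v).
Proof.
move=> cphi; have s0 := sin_cR_gt0 p.
have dL := is_derive_linear a b p v.
have dt := is_derive_comp1 (is_derive_phase p v) (is_derive_tan cphi).
have dw := is_deriveM_fun (is_derive_cst (sin theta) p v) dt.
have da := is_derive_comp1 dw (is_derive1_atan _).
apply: is_derive_eq (is_deriveD_fun dL da) _.
congr (_ + _); rewrite /cst /= mulr0 addr0 /tau.
have sR : sin (cR u p) ^+ 2 =
    cos (phi p) ^+ 2 + sin theta ^+ 2 * sin (phi p) ^+ 2.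
  rewrite sin2cos2 cos_cR [sin theta ^+ 2]sin2cos2 exprMn.
  by rewrite [cos (phi p) ^+ 2]cos2sin2; ring.
have sR0 : sin (cR u p) ^+ 2 != 0 by rewrite sqrf_eq0 gt_eqF.
rewrite sR in sR0 *; rewrite /tan; field.
by rewrite exprMn sR0; exact: cphi.
Qed.

Lemma Ck_tau n (D : set (R * R)) : open D -> Ck n D tau.
Proof.
move=> oD; apply: Ck_mul (Ck_cst _ _ _) _ => //.
apply: Ck_inv (Ck_sqr oD (Ck_comp oD (Ck_sin_cos n).1 (Ck_cR n oD))) => // p _.
by rewrite sqrf_eq0 gt_eqF// sin_cR_gt0.
Qed.

Lemma Ck_cS n (D : set (R * R)) : open D -> D `<=` umap_dom a b c ->
  Ck n D (cS u).
Proof.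
move=> oD Ddom; have cc p : D p -> {for p, continuous (cS u)}.
  move=> Dp; pose w q := sin theta * tan (phi q).
  have cw : {for p, continuous w}.
    apply: Ck_continuous Dp; apply: Ck_mul (Ck_cst 0 _ _) _ => //.
    apply: Ck_mul (Ck_comp oD (Ck_sin_cos 0).1 (Ck_phase 0 oD)) _ => //.
    exact: Ck_inv oD Ddom (Ck_comp oD (Ck_sin_cos 0).2 (Ck_phase 0 oD)).
  have cl := Ck_continuous (Ck_linear 0 a b oD) Dp.
  apply: cvgD; first exact: cl.
  exact: (@continuous_comp _ _ _ w atan p cw (@continuous_atan R _)).
case: n => [|n]; first by split.
apply: (@CkS_intro _ _ _ _ _
  (fun v p => a * v.1 + b * v.2 + tau p * dphi v)) => //.
- by move=> v p /Ddom; exact: is_derive_cS.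
- move=> v.
  exact: Ck_add oD (Ck_cst _ _ _) (Ck_mul oD (Ck_tau _ oD) (Ck_cst _ _ _)).
Qed.

Lemma open_umap_dom : open (umap_dom a b c).
Proof.
have oT := @openT (R * R)%type.
have := open_neq0 oT (Ck_comp oT (Ck_sin_cos 0).2 (Ck_phase 0 oT)).
by rewrite (_ : [set p | _] = umap_dom a b c)//; apply/seteqP; split=> [p []|p].
Qed.

Lemma is_derive_ellA (t : R) :
  is_derive t (1 : R) (ellA c) (2 * (c ^+ 2 - 1) * sin t * cos t).
Proof.
have ds := is_deriveM_fun (is_derive_sin t) (is_derive_sin t).
have dc := is_deriveM_fun (is_derive_cos t) (is_derive_cos t).
have dcs := is_deriveM_fun (is_derive_cst (c ^+ 2) t (1 : R)) ds.
by apply: is_derive_eq (is_deriveD_fun dcs dc) _; rewrite /cst; ring.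
Qed.

Lemma is_derive_ellB (t : R) :
  is_derive t (1 : R) ellB (2 * sin t * cos t).
Proof.
apply: is_derive_eq (is_deriveM_fun (is_derive_sin t) (is_derive_sin t)) _.
by ring.
Qed.

(** Conservation of speed along the great circle of angular momentum
    [sin theta]. *)
Lemma sqr_psi p : (1 - psi p ^+ 2) * sin (cR u p) ^+ 2 = sin theta ^+ 2.
Proof.
have s0 : sin (cR u p) != 0 by rewrite gt_eqF// sin_cR_gt0.
rewrite mulrBl mul1r -exprMn /psi divfK// sqrrN sin2cos2 cos_cR.
by rewrite [RHS]sin2cos2 !exprMn [cos (phi p) ^+ 2]cos2sin2; ring.
Qed.

(** The equation of geodesics [R'' = sin R cos R tau^2], in which [tau^2] is
    eliminated by means of [sqr_psi]. *)
Lemma is_derive_psi p v : is_derive p v psi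
  (cos (cR u p) / sin (cR u p) * (1 - psi p ^+ 2) * dphi v).
Proof.
have s0 : sin (cR u p) != 0 by rewrite gt_eqF// sin_cR_gt0.
have dc := is_derive_comp1 (is_derive_phase p v) (is_derive_cos (phi p)).
have dk := is_deriveM_fun (is_derive_cst (- cos theta) p v) dc.
have ds := is_derive_comp1 (is_derive_cR p v) (is_derive_sin (cR u p)).
have := is_deriveM_fun dk (is_deriveV_fun s0 ds).
have -> : (fun y => cst (- cos theta) y * cos (phi y) / sin (cR u y)) = psi.
  by apply/funext => q; rewrite /psi mulNr.
move=> h; apply: is_derive_eq h _.
have cE : cos theta * cos (phi p) = - psi p * sin (cR u p).
  by rewrite /psi mulNr divfK// opprK.
transitivity ((cos theta * cos (phi p)) * (sin (cR u p) ^- 2 *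
    (cos (cR u p) * (psi p * dphi v))) +
    (sin (cR u p))^-1 * (cos theta * sin (phi p) * dphi v)).
  by rewrite /cst; ring.
by rewrite cE -cos_cR; field.
Qed.

Lemma derive_ellA_flux v p : 'D_v (fun q => ellA c (cR u q) * 'D_v (cR u) q) p =
  (2 * (c ^+ 2 - 1) * sin (cR u p) * cos (cR u p) * psi p ^+ 2 +
   ellA c (cR u p) * (cos (cR u p) / sin (cR u p) * (1 - psi p ^+ 2)))
  * dphi v ^+ 2.
Proof.
have -> : (fun q => ellA c (cR u q) * 'D_v (cR u) q) =
    (fun q => ellA c (cR u q) * (psi q * dphi v)).
  by apply/funext => q; rewrite (derive_val (is_derive := is_derive_cR q v)).
have dA := is_derive_comp1 (is_derive_cR p v) (is_derive_ellA (cR u p)).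
have dG := is_deriveM_fun (is_derive_psi p v) (is_derive_cst (dphi v) p v).
have [_ ->] := is_deriveM_fun dA dG.
by rewrite /cst; ring.
Qed.

(** As [B = sin^2 R], the part [B tau grad phi] of [B grad S] is the constant
    field [sin theta grad phi]; only the part coming from [a x + b y] is
    differentiated. *)
Lemma derive_ellB_flux v p : umap_dom a b c p ->
  'D_v (fun q => ellB (cR u q) * 'D_v (cS u) q) p =
  2 * sin (cR u p) * cos (cR u p) * psi p * dphi v * (a * v.1 + b * v.2).
Proof.
move=> dom_p.
have -> : 'D_v (fun q => ellB (cR u q) * 'D_v (cS u) q) p =
    'D_v (fun q => ellB (cR u q) * (a * v.1 + b * v.2) + sin theta * dphi v) p.
  apply: near_eq_derive; near=> q.
  have dom_q : umap_dom a b c q.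
    by near: q; apply: open_nbhs_nbhs; split=> //; exact: open_umap_dom.
  have [_ ->] := is_derive_cS v dom_q.
  have s0 : sin (cR u q) != 0 by rewrite gt_eqF// sin_cR_gt0.
  by rewrite /ellB /tau; field.
have dB := is_derive_comp1 (is_derive_cR p v) (is_derive_ellB (cR u p)).
have dBL := is_deriveM_fun dB (is_derive_cst (a * v.1 + b * v.2) p v).
have [_ ->] := is_deriveD_fun dBL (is_derive_cst (sin theta * dphi v) p v).
by rewrite /cst; ring.
Unshelve. all: by end_near. Qed.

(** Both equations reduce to identities between rational functions through
    [a phi_x + b phi_y = 0] and [a^2 + b^2 = k^2 (phi_x^2 + phi_y^2)]; the square
    of [tau] is eliminated by means of [sqr_psi]. *)
Lemma euler_lagrange_umap p : umap_dom a b c p ->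
  euler_lagrange (ellA c) ellB u p.
Proof.
move=> dom_p; have s0 : sin (cR u p) != 0 by rewrite gt_eqF// sin_cR_gt0.
have k0 : k != 0 by rewrite gt_eqF// k_gt0.
have c2 : cos (cR u p) ^+ 2 = 1 - sin (cR u p) ^+ 2 := cos2sin2 _.
have dx : dphi ((1, 0) : R * R) = - b / k by rewrite /dphi /=; ring.
have dy : dphi ((0, 1) : R * R) = a / k by rewrite /dphi /=; ring.
have Rx : pdx (cR u) p = psi p * (- b / k).
  by rewrite -dx; have [_] := is_derive_cR p ((1, 0) : R * R).
have Ry : pdy (cR u) p = psi p * (a / k).
  by rewrite -dy; have [_] := is_derive_cR p ((0, 1) : R * R).
have Sx : pdx (cS u) p = a * 1 + b * 0 + tau p * (- b / k).
  by rewrite -dx; have [_] := is_derive_cS ((1, 0) : R * R) dom_p.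
have Sy : pdy (cS u) p = a * 0 + b * 1 + tau p * (a / k).
  by rewrite -dy; have [_] := is_derive_cS ((0, 1) : R * R) dom_p.
have Ax := derive_ellA_flux ((1, 0) : R * R) p.
have Ay := derive_ellA_flux ((0, 1) : R * R) p.
have Bx := derive_ellB_flux ((1, 0) : R * R) dom_p.
have By := derive_ellB_flux ((0, 1) : R * R) dom_p.
split; last by rewrite [pdx _ _]Bx [pdy _ _]By dx dy /=; field.
rewrite [pdx (fun q => _) p]Ax [pdy (fun q => _) p]Ay Rx Ry Sx Sy dx dy.
have [_ ->] := is_derive_ellA (cR u p); have [_ ->] := is_derive_ellB (cR u p).
have t2 : tau p ^+ 2 = (1 - psi p ^+ 2) / sin (cR u p) ^+ 2.
  by rewrite /tau exprMn -(sqr_psi p); field.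
have -> : (a * 1 + b * 0 + tau p * (- b / k)) ^+ 2 +
    (a * 0 + b * 1 + tau p * (a / k)) ^+ 2 =
    (a ^+ 2 + b ^+ 2) / k ^+ 2 * (k ^+ 2 + tau p ^+ 2) by field.
rewrite t2 /ellA; move: k0 sqr_k; move: k => m m0 mE.
have -> : c ^+ 2 = m ^+ 2 + 1 by rewrite mE subrK.
move: (sin (cR u p)) (cos (cR u p)) (psi p) s0 c2 => s C w s0 C2.
have -> : (m ^+ 2 + 1) * s ^+ 2 + C ^+ 2 = 1 + m ^+ 2 * s ^+ 2.
  by rewrite C2; ring.
by field; rewrite s0.
Qed.

End EllipsoidMap.

Section Domain.
Context {R : realType}.

Lemma open_harmonic_domain (a b c theta : R) (M : set (R * R)) : 1 < c ->
  0 < theta < pi / 2 -> open M ->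
  open [set p | [/\ M p, umap_dom a b c p & jac (umap a b c theta) p != 0]].
Proof.
move=> c1 thI oM; set u := umap a b c theta.
have oD : open (umap_dom a b c) by exact: open_umap_dom.
have CR : Ck 1 (umap_dom a b c) (cR u) by exact: Ck_cR.
have CS : Ck 1 (umap_dom a b c) (cS u) by exact: Ck_cS.
have Cj : Ck 0 (umap_dom a b c) (jac u).
  exact: Ck_sub oD (Ck_mul oD (CkS_derive _ CR) (CkS_derive _ CS))
    (Ck_mul oD (CkS_derive _ CR) (CkS_derive _ CS)).
rewrite (_ : [set p | _] =
    M `&` [set p | umap_dom a b c p /\ jac u p != 0]); last first.
  by apply/seteqP; split=> p [] // ? [].
exact: openI oM (open_neq0 oD Cj).
Qed.

Lemma Ck_ellA n (c : R) : Ck n setT (ellA c).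
Proof.
have oT := @openT R; have [Cs Cc] := @Ck_sin_cos R n.
exact: Ck_add oT (Ck_mul oT (Ck_cst _ _ _) (Ck_sqr oT Cs)) (Ck_sqr oT Cc).
Qed.

Lemma Ck_ellB n : Ck n setT (@ellB R).
Proof. exact: Ck_sqr (@openT R) (@Ck_sin_cos R n).1. Qed.

End Domain.

Theorem proposition7 (R : realType) (c theta a b : R)
    (M : set (R * R)) (f : R * R -> R) :
  1 < c -> 0 < theta < pi / 2 ->
  open M -> smooth_on M f ->
  harmonic_on f (ellA c) ellB ell_chart
    [set p | [/\ M p, umap_dom a b c p & jac (umap a b c theta) p != 0]]
    (umap a b c theta).
Proof.
move=> c1 thI oM _; set W := [set p | _]; set u := umap a b c theta.
have oW : open W by exact: open_harmonic_domain.
have Wdom : W `<=` umap_dom a b c by move=> p [].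
have CR n : Ck n W (cR u) by exact: Ck_cR.
have CS n : Ck n W (cS u) by exact: Ck_cS.
split=> //.
- by move=> p _; exact: umap_chart.
- move=> K e h cK KW e0; apply: energy_stationary => //.
  + exact: Ck_ellA.
  + exact: Ck_ellB.
  + by move=> p /Wdom; exact: euler_lagrange_umap.
Qed.
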